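(* Let $\mathbb{H}$ be a localic triangulated $\mathcal{S}$-fibered category, let $(\otimes,m)$ be a localic internal tensor structure on $\mathbb{H}$ over $\mathcal{U}$, and let $(\tilde{\otimes},\tilde{m})$ denote the internal tensor structure over $\mathcal{S}$ extending it. Then the following statements hold: (1) Suppose that we are given compatible internal associativity and commutativity constraints $a$ and $c$ on $(\otimes,m)$. Then the extended constraints $\tilde{a}$ and $\tilde{c}$ on $(\tilde{\otimes},\tilde{m})$ are compatible as well. (2) Suppose that we are given compatible internal associativity and unit constraints $a$ and $u$ on $(\otimes,m)$. Then the extended constraints $\tilde{a}$ and $\tilde{u}$ on $(\tilde{\otimes},\tilde{m})$ are compatible as well. (3) Suppose that we are given compatible internal commutativity and unit constraints $c$ and $u$ on $(\otimes,m)$. Then the extended constraints $\tilde{c}$ and $\tilde{u}$ on $(\tilde{\otimes},\tilde{m})$ are compatible as well.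
   Context: Base category. $\mathcal{S}$ is a fixed small category with finite products and final object $\ast$, equipped with two (possibly non-full) subcategories $\mathcal{S}^{sm}$ (its morphisms are called smooth morphisms) and $\mathcal{S}^{cl}$ (its morphisms are called closed immersions) such that: (i) both have the same objects as $\mathcal{S}$ and contain all isomorphisms of $\mathcal{S}$; (ii) for every smooth $p: P \to S$ and every $f: T \to S$ in $\mathcal{S}$ the fibered product $P\times_S T$ exists in $\mathcal{S}$ and its projection to $T$ is smooth; (iii) for every smooth $p: P\to S$ and closed immersion $z: Z\to S$ the projection $P\times_S Z\to P$ is a closed immersion, and whenever $z: Z\to S$, $g: S\to V$ are morphisms of $\mathcal{S}$ with $gz$ a closed immersion, $z$ is a closed immersion; (iv) every $f: T\to S$ in $\mathcal{S}$ factors as $f=p\circ t$ with $t: T\to P$ a closed immersion and $p: P\to S$ smooth. $\mathcal{U}$ is the full subcategory of $\mathcal{S}$ of all $Y$ such that $Y\to\ast$ is smooth; its smooth morphisms and closed immersions are those of $\mathcal{S}$ lying in $\mathcal{U}$. Moreover: (v) $\mathcal{S}$ has an initial object $\emptyset$; (vi) for every closed immersion $z: Z\to S$ there is a distinguished smooth morphism $u: U\to S$ (the open immersion complementary to $z$; $U$ is the open complement of $Z$ in $S$) such that for every $T\in\mathcal{S}$ composition with $u$ identifies $\mathrm{Hom}_{\mathcal{S}}(T,U)$ with the subset of those $f\in\mathrm{Hom}_{\mathcal{S}}(T,S)$ for which the square with sides $\emptyset\to T$, $f:T\to S$, $\emptyset\to Z$, $z: Z\to S$ is Cartesian; (vii)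 for every $S\in\mathcal{S}$ there is a finite sequence of closed immersions $\emptyset=Z_{-1}\to Z_0\to\cdots\to Z_n=S$ such that for each $r=0,\dots,n$ the open complement of $Z_{r-1}$ in $Z_r$ belongs to $\mathcal{U}$. Fibered categories. Let $\mathcal{C}$ be $\mathcal{S}$ or $\mathcal{U}$. A $\mathcal{C}$-fibered category $\mathbb{H}$ consists of a category $\mathbb{H}(S)$ for each $S\in\mathcal{C}$, a functor $f^*:\mathbb{H}(S)\to\mathbb{H}(T)$ for each $f: T\to S$ in $\mathcal{C}$, and natural isomorphisms $\mathsf{conn}_{f,g}:(gf)^*\xrightarrow{\sim} f^*g^*$ for composable $f: T\to S$, $g: S\to V$, such that $\mathrm{id}_S^*=\mathrm{id}_{\mathbb{H}(S)}$ and, for composable $f,g,h$, the two resulting isomorphisms $(hgf)^*\xrightarrow{\sim} f^*g^*h^*$ agree. Connection isomorphisms are written as equalities. An $\mathcal{S}$-fibered category restricts to a $\mathcal{U}$-fibered category, denoted by the same symbol. Localic fibered categories. A triangulated $\mathcal{C}$-fibered category is one where all $\mathbb{H}(S)$ are triangulated categories, all $f^*$ are triangulated functors and all connection isomorphisms are isomorphisms of triangulated functors. It is localic if: (a) $\mathbb{H}(\emptyset)=0$; (b) for every smooth $p: P\to S$ the functor $p^*$ has a left adjoint $p_\#$, and for every Cartesian square with $p: P\to S$ smooth, $f: T\to S$, $p': P_T\to T$, $f': P_T\to P$, the composite $p'_\#f'^*\xrightarrow{\eta}p'_\#f'^*p^*p_\#=p'_\#p'^*f^*p_\#\xrightarrow{\epsilon}f^*p_\#$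 is invertible; (c) for every closed immersion $z: Z\to S$ the functor $z^*$ has a right adjoint $z_*$, which is fully faithful; (d) for every closed immersion $z$ with complementary open immersion $u$, the pair $(z^*,u^* )$ is conservative. Here $\eta$ and $\epsilon$ denote units and co-units of adjunctions. A localic $\mathcal{S}$-fibered category restricts to a localic $\mathcal{U}$-fibered category. Tensor structures. An internal tensor structure $(\otimes,m)$ on a $\mathcal{C}$-fibered category $\mathbb{H}$ consists of functors $-\otimes-:\mathbb{H}(S)\times\mathbb{H}(S)\to\mathbb{H}(S)$ for $S\in\mathcal{C}$ and natural isomorphisms $m_f: f^*A\otimes f^*B\xrightarrow{\sim}f^*(A\otimes B)$ for $f: T\to S$ in $\mathcal{C}$ such that for composable $f,g$ the isomorphism $m_{gf}$ equals the composite $f^*g^*A\otimes f^*g^*B\xrightarrow{m_f}f^*(g^*A\otimes g^*B)\xrightarrow{m_g}f^*g^*(A\otimes B)$ (modulo connection isomorphisms). It is triangulated if the functors $\otimes$ are bi-triangulated and the $m_f$ are isomorphisms of bi-triangulated functors. A triangulated internal tensor structure is localic if for every smooth $p: P\to S$ in $\mathcal{C}$ the composites $p_\#(A\otimes p^*B)\xrightarrow{\eta}p_\#(p^*p_\#A\otimes p^*B)\xrightarrow{m}p_\#p^*(p_\#A\otimes B)\xrightarrow{\epsilon}p_\#A\otimes B$ and $p_\#(p^*A\otimes B)\xrightarrow{\eta}p_\#(p^*A\otimes p^*p_\#B)\xrightarrow{m}p_\#p^*(A\otimes p_\#B)\xrightarrow{\epsilon}A\otimes p_\#B$ are invertible.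 Every localic internal tensor structure $(\otimes,m)$ over $\mathcal{U}$ on (the restriction of) a localic $\mathcal{S}$-fibered category extends, uniquely up to unique equivalence, to a triangulated internal tensor structure $(\tilde\otimes,\tilde m)$ over $\mathcal{S}$ whose restriction to $\mathcal{U}$ is $(\otimes,m)$. Constraints. Let $(\otimes,m)$ be an internal tensor structure over $\mathcal{C}$. - An internal associativity constraint $a$ is a family of natural isomorphisms $a_S:(A\otimes B)\otimes C\xrightarrow{\sim}A\otimes(B\otimes C)$, $S\in\mathcal{C}$, satisfying the usual pentagon axiom for every $S$ and, for every $f: T\to S$ in $\mathcal{C}$, such that $(f^*A\otimes f^*B)\otimes f^*C\xrightarrow{m}f^*(A\otimes B)\otimes f^*C\xrightarrow{m}f^*((A\otimes B)\otimes C)\xrightarrow{a}f^*(A\otimes(B\otimes C))$ equals $(f^*A\otimes f^*B)\otimes f^*C\xrightarrow{a}f^*A\otimes(f^*B\otimes f^*C)\xrightarrow{m}f^*A\otimes f^*(B\otimes C)\xrightarrow{m}f^*(A\otimes(B\otimes C))$. - An internal commutativity constraint $c$ is a family of natural isomorphisms $c_S: A\otimes B\xrightarrow{\sim}B\otimes A$, $S\in\mathcal{C}$, with $c\circ c=\mathrm{id}$ and $m_f\circ c_T=f^*(c_S)\circ m_f$ for every $f: T\to S$. - A section $A$ of $\mathbb{H}$ over $\mathcal{C}$ consists of objects $A_S\in\mathbb{H}(S)$ and isomorphisms $A_f^*: f^*A_S\xrightarrow{\sim}A_T$ for $f: T\to S$ with $A_{gf}^*=A_f^*\circ f^*(A_g^*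 )$ for composable $f: V\to T$, $g: T\to S$. Every section over $\mathcal{U}$ extends, uniquely up to unique isomorphism restricting to the identity over $\mathcal{U}$, to a section over $\mathcal{S}$. An internal unit constraint $u$ consists of a section $\mathbf{1}$ over $\mathcal{C}$ (the unit section) and natural isomorphisms $u_{r,S}: A\otimes\mathbf{1}_S\xrightarrow{\sim}A$, $u_{l,S}:\mathbf{1}_S\otimes B\xrightarrow{\sim}B$, $S\in\mathcal{C}$, such that $u_{r,S}=u_{l,S}$ on $\mathbf{1}_S\otimes\mathbf{1}_S$ and, for every $f: T\to S$, $u_{r,T}\circ(\mathrm{id}\otimes\mathbf{1}_f^* )=f^*(u_{r,S})\circ m_f$ on $f^*A\otimes f^*\mathbf{1}_S$ and $u_{l,T}\circ(\mathbf{1}_f^*\otimes\mathrm{id})=f^*(u_{l,S})\circ m_f$ on $f^*\mathbf{1}_S\otimes f^*B$. Constraints $a$, $c$, $u$ on $(\otimes,m)$ over $\mathcal{U}$ extend uniquely to constraints $\tilde a$, $\tilde c$, $\tilde u$ of the same kind on $(\tilde\otimes,\tilde m)$ over $\mathcal{S}$ restricting to the given ones ($\tilde u$ having as unit section $\tilde{\mathbf{1}}$ the extension of $\mathbf{1}$); these are the extended constraints. Compatibility (for each $S\in\mathcal{C}$). - $a$ and $c$ are compatible if $(A\otimes B)\otimes C\xrightarrow{c}(B\otimes A)\otimes C\xrightarrow{a}B\otimes(A\otimes C)\xrightarrow{c}B\otimes(C\otimes A)$ equals $(A\otimes B)\otimes C\xrightarrow{a}A\otimes(B\otimes C)\xrightarrow{c}(B\otimes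 C)\otimes A\xrightarrow{a}B\otimes(C\otimes A)$. - $a$ and $u$ are compatible if: $(\mathbf{1}_S\otimes B)\otimes C\xrightarrow{a}\mathbf{1}_S\otimes(B\otimes C)\xrightarrow{u_l}B\otimes C$ equals $u_l\otimes\mathrm{id}_C$; $(A\otimes\mathbf{1}_S)\otimes C\xrightarrow{a}A\otimes(\mathbf{1}_S\otimes C)\xrightarrow{u_l}A\otimes C$ equals $u_r\otimes\mathrm{id}_C$; and $(A\otimes B)\otimes\mathbf{1}_S\xrightarrow{a}A\otimes(B\otimes\mathbf{1}_S)\xrightarrow{u_r}A\otimes B$ equals $u_r$. - $c$ and $u$ are compatible if $\mathbf{1}_S\otimes B\xrightarrow{c}B\otimes\mathbf{1}_S\xrightarrow{u_r}B$ equals $u_l$. *)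

(* Defs.v *)
Set Implicit Arguments.
Unset Strict Implicit.
Unset Printing Implicit Defensive.

(** Composition is written in diagrammatic order throughout:
    [f >> g] is "first [f], then [g]". *)

Record Category := {
  Ob :> Type;
  Hom : Ob -> Ob -> Type;
  idm : forall A, Hom A A;
  comp : forall A B C, Hom A B -> Hom B C -> Hom A C;
  comp_idl : forall A B (f : Hom A B), comp (idm A) f = f;
  comp_idr : forall A B (f : Hom A B), comp f (idm B) = f;
  comp_assoc : forall A B C D (f : Hom A B) (g : Hom B C) (h : Hom C D),
    comp f (comp g h) = comp (comp f g) h
}.
Arguments Hom {c} _ _.
Arguments idm {c} _.
Arguments comp {c A B C} _ _.
Arguments comp_assoc {c A B C D} _ _ _.

Declare Scope cat_scope.
Open Scope cat_scope.
Notation "f >> g" := (comp f g) (at level 50, left associativity) : cat_scope.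

Definition is_iso (C : Category) (A B : C) (f : Hom A B) : Prop :=
  exists g : Hom B A, f >> g = idm A /\ g >> f = idm B.

Definition is_initial (C : Category) (X : C) : Prop :=
  forall Y : C, exists f : Hom X Y, forall g, g = f.

Definition is_terminal (C : Category) (X : C) : Prop :=
  forall Y : C, exists f : Hom Y X, forall g, g = f.

Definition is_zero_object (C : Category) (X : C) : Prop :=
  is_initial X /\ is_terminal X.

Definition is_product (C : Category) (X Y P : C) (p : Hom P X) (q : Hom P Y)
  : Prop :=
  forall (T : C) (a : Hom T X) (b : Hom T Y),
    exists! t : Hom T P, t >> p = a /\ t >> q = b.

(** The square [P -p-> X -f-> S], [P -q-> Y -g-> S] is Cartesian. *)
Definition is_pullback (C : Category) (X Y S P : C)
  (p : Hom P X) (q : Hom P Y) (f : Hom X S) (g : Hom Y S) : Prop :=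
  p >> f = q >> g /\
  forall (T : C) (a : Hom T X) (b : Hom T Y), a >> f = b >> g ->
    exists! t : Hom T P, t >> p = a /\ t >> q = b.

Definition full_subcat (C : Category) (P : C -> Prop) : Category := {|
  Ob := {X : C | P X};
  Hom := fun X Y => Hom (proj1_sig X) (proj1_sig Y);
  idm := fun X => idm (proj1_sig X);
  comp := fun X Y Z f g => f >> g;
  comp_idl := fun X Y f => comp_idl f;
  comp_idr := fun X Y f => comp_idr f;
  comp_assoc := fun X Y Z W f g h => comp_assoc f g h
|}.

Definition prod_cat (C D : Category) : Category := {|
  Ob := Ob C * Ob D;
  Hom := fun X Y => (Hom (fst X) (fst Y) * Hom (snd X) (snd Y))%type;
  idm := fun X => (idm (fst X), idm (snd X));
  comp := fun X Y Z f g => (fst f >> fst g, snd f >> snd g);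
  comp_idl := fun X Y f =>
    match f with (f1, f2) => f_equal2 pair (comp_idl f1) (comp_idl f2) end;
  comp_idr := fun X Y f =>
    match f with (f1, f2) => f_equal2 pair (comp_idr f1) (comp_idr f2) end;
  comp_assoc := fun X Y Z W f g h =>
    f_equal2 pair (comp_assoc (fst f) (fst g) (fst h))
                  (comp_assoc (snd f) (snd g) (snd h))
|}.

Record Functor (C D : Category) := {
  fob :> C -> D;
  fmor : forall A B : C, Hom A B -> Hom (fob A) (fob B);
  fmor_id : forall A, fmor (idm A) = idm (fob A);
  fmor_comp : forall (A B E : C) (f : Hom A B) (g : Hom B E),
    fmor (f >> g) = fmor f >> fmor g
}.
Arguments fmor {C D} f0 {A B} _ : rename.

Definition id_functor (C : Category) : Functor C C := {|
  fob := fun A => A;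
  fmor := fun A B f => f;
  fmor_id := fun A => eq_refl;
  fmor_comp := fun A B E f g => eq_refl
|}.

Definition fully_faithful (C D : Category) (F : Functor C D) : Prop :=
  forall (A B : C) (g : Hom (F A) (F B)), exists! f : Hom A B, fmor F f = g.

Definition essentially_surjective (C D : Category) (F : Functor C D) : Prop :=
  forall B : D, exists (A : C) (f : Hom (F A) B), is_iso f.

Record Adjunction (C D : Category) (L : Functor C D) (R : Functor D C) := {
  adj_unit : forall A : C, Hom A (R (L A));
  adj_counit : forall B : D, Hom (L (R B)) B;
  unit_nat : forall (A A' : C) (f : Hom A A'),
    f >> adj_unit A' = adj_unit A >> fmor R (fmor L f);
  counit_nat : forall (B B' : D) (g : Hom B B'),
    fmor L (fmor R g) >> adj_counit B' = adj_counit B >> g;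
  triangle_l : forall A : C,
    fmor L (adj_unit A) >> adj_counit (L A) = idm (L A);
  triangle_r : forall B : D,
    adj_unit (R B) >> fmor R (adj_counit B) = idm (R B)
}.

(** The isomorphism [F i A -> F j A] induced by an equality [i = j]. *)
Definition transport (I : Type) (C D : Category) (F : I -> Functor C D)
  (i j : I) (e : i = j) (A : C) : Hom (F i A) (F j A) :=
  match e in _ = k return Hom (F i A) (F k A) with
  | eq_refl => idm (F i A)
  end.

Definition bob (C D E : Category) (F : Functor (prod_cat C D) E)
  (A : C) (B : D) : E := F (A, B).

Definition bmor (C D E : Category) (F : Functor (prod_cat C D) E)
  (A A' : C) (B B' : D) (f : Hom A A') (g : Hom B B')
  : Hom (bob F A B) (bob F A' B') :=
  @fmor (prod_cat C D) E F (A, B) (A', B') (f, g).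

Record AdditiveStructure (C : Category) := {
  hzero : forall A B : C, Hom A B;
  hadd : forall A B : C, Hom A B -> Hom A B -> Hom A B;
  hopp : forall A B : C, Hom A B -> Hom A B;
  hadd_assoc : forall (A B : C) (f g h : Hom A B),
    hadd f (hadd g h) = hadd (hadd f g) h;
  hadd_comm : forall (A B : C) (f g : Hom A B), hadd f g = hadd g f;
  hadd_zero : forall (A B : C) (f : Hom A B), hadd (hzero A B) f = f;
  hadd_opp : forall (A B : C) (f : Hom A B), hadd (hopp f) f = hzero A B;
  comp_hadd_l : forall (A B E : C) (f f' : Hom A B) (g : Hom B E),
    hadd f f' >> g = hadd (f >> g) (f' >> g);
  comp_hadd_r : forall (A B E : C) (f : Hom A B) (g g' : Hom B E),
    f >> hadd g g' = hadd (f >> g) (f >> g');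
  zero_object : exists Z : C, is_zero_object Z;
  biproduct : forall A B : C, exists (P : C)
    (i : Hom A P) (j : Hom B P) (p : Hom P A) (q : Hom P B),
    i >> p = idm A /\ j >> q = idm B /\
    i >> q = hzero A B /\ j >> p = hzero B A /\
    hadd (p >> i) (q >> j) = idm P
}.

Definition additive (C D : Category) (aC : AdditiveStructure C)
  (aD : AdditiveStructure D) (F : Functor C D) : Prop :=
  forall (A B : C) (f g : Hom A B),
    fmor F (hadd aC f g) = hadd aD (fmor F f) (fmor F g).

(** The shift is an additive auto-equivalence, not necessarily strictly
    invertible; [dist f g h] says that [X -f-> Y -g-> Z -h-> X[1]] is
    distinguished. *)
Record TriangulatedStructure (C : Category) := {
  tri_add :> AdditiveStructure C;
  shift : Functor C C;
  shift_additive : additive tri_add tri_add shift;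
  shift_ff : fully_faithful shift;
  shift_es : essentially_surjective shift;
  dist : forall X Y Z : C, Hom X Y -> Hom Y Z -> Hom Z (shift X) -> Prop;
  dist_iso : forall (X Y Z X' Y' Z' : C)
    (f : Hom X Y) (g : Hom Y Z) (h : Hom Z (shift X))
    (f' : Hom X' Y') (g' : Hom Y' Z') (h' : Hom Z' (shift X'))
    (a : Hom X X') (b : Hom Y Y') (c : Hom Z Z'),
    is_iso a -> is_iso b -> is_iso c ->
    f >> b = a >> f' -> g >> c = b >> g' -> h >> fmor shift a = c >> h' ->
    dist f g h -> dist f' g' h';
  dist_id : forall X Z : C, is_zero_object Z ->
    dist (idm X) (hzero tri_add X Z) (hzero tri_add Z (shift X));
  dist_cone : forall (X Y : C) (f : Hom X Y),
    exists (Z : C) (g : Hom Y Z) (h : Hom Z (shift X)), dist f g h;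
  dist_rotate : forall (X Y Z : C)
    (f : Hom X Y) (g : Hom Y Z) (h : Hom Z (shift X)),
    dist f g h <-> dist g h (hopp tri_add (fmor shift f));
  dist_complete : forall (X Y Z X' Y' Z' : C)
    (f : Hom X Y) (g : Hom Y Z) (h : Hom Z (shift X))
    (f' : Hom X' Y') (g' : Hom Y' Z') (h' : Hom Z' (shift X'))
    (a : Hom X X') (b : Hom Y Y'),
    dist f g h -> dist f' g' h' -> f >> b = a >> f' ->
    exists c : Hom Z Z', g >> c = b >> g' /\ h >> fmor shift a = c >> h';
  dist_octahedral : forall (X Y Z X' Y' Z' : C)
    (f : Hom X Y) (g : Hom Y Z)
    (u : Hom Y Z') (v : Hom Z' (shift X))
    (u' : Hom Z X') (v' : Hom X' (shift Y))
    (u'' : Hom Z Y') (v'' : Hom Y' (shift X)),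
    dist f u v -> dist g u' v' -> dist (f >> g) u'' v'' ->
    exists (a : Hom Z' Y') (b : Hom Y' X'),
      dist a b (v' >> fmor shift u) /\
      u >> a = g >> u'' /\ a >> v'' = v /\
      u'' >> b = u' /\ b >> v' = v'' >> fmor shift f
}.

Record TriFunctorStructure (C D : Category)
  (tC : TriangulatedStructure C) (tD : TriangulatedStructure D)
  (F : Functor C D) := {
  fshift : forall A : C, Hom (F (shift tC A)) (shift tD (F A));
  fshift_iso : forall A, is_iso (fshift A);
  fshift_nat : forall (A B : C) (f : Hom A B),
    fmor F (fmor (shift tC) f) >> fshift B
    = fshift A >> fmor (shift tD) (fmor F f);
  fshift_additive : additive tC tD F;
  fshift_dist : forall (X Y Z : C)
    (f : Hom X Y) (g : Hom Y Z) (h : Hom Z (shift tC X)),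
    dist f g h -> dist (fmor F f) (fmor F g) (fmor F h >> fshift X)
}.

(** Triangulated in each variable, the two identifications of
    [F (A[1], B[1])] with [F (A, B)[2]] differing by the sign -1. *)
Record BiTriFunctorStructure (C D E : Category)
  (tC : TriangulatedStructure C) (tD : TriangulatedStructure D)
  (tE : TriangulatedStructure E) (F : Functor (prod_cat C D) E) := {
  shiftl : forall (A : C) (B : D),
    Hom (bob F (shift tC A) B) (shift tE (bob F A B));
  shiftl_iso : forall A B, is_iso (shiftl A B);
  shiftl_nat : forall (A A' : C) (B B' : D) (f : Hom A A') (g : Hom B B'),
    bmor F (fmor (shift tC) f) g >> shiftl A' B'
    = shiftl A B >> fmor (shift tE) (bmor F f g);
  shiftr : forall (A : C) (B : D),
    Hom (bob F A (shift tD B)) (shift tE (bob F A B));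
  shiftr_iso : forall A B, is_iso (shiftr A B);
  shiftr_nat : forall (A A' : C) (B B' : D) (f : Hom A A') (g : Hom B B'),
    bmor F f (fmor (shift tD) g) >> shiftr A' B'
    = shiftr A B >> fmor (shift tE) (bmor F f g);
  shift_anticomm : forall (A : C) (B : D),
    shiftl A (shift tD B) >> fmor (shift tE) (shiftr A B)
    = hopp tE (shiftr (shift tC A) B >> fmor (shift tE) (shiftl A B));
  biadditive_l : forall (A A' : C) (B : D) (f f' : Hom A A'),
    bmor F (hadd tC f f') (idm B)
    = hadd tE (bmor F f (idm B)) (bmor F f' (idm B));
  biadditive_r : forall (A : C) (B B' : D) (g g' : Hom B B'),
    bmor F (idm A) (hadd tD g g')
    = hadd tE (bmor F (idm A) g) (bmor F (idm A) g');
  bidist_l : forall (X Y Z : C) (B : D)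
    (f : Hom X Y) (g : Hom Y Z) (h : Hom Z (shift tC X)),
    dist f g h ->
    dist (bmor F f (idm B)) (bmor F g (idm B))
         (bmor F h (idm B) >> shiftl X B);
  bidist_r : forall (A : C) (X Y Z : D)
    (f : Hom X Y) (g : Hom Y Z) (h : Hom Z (shift tD X)),
    dist f g h ->
    dist (bmor F (idm A) f) (bmor F (idm A) g)
         (bmor F (idm A) h >> shiftr A X)
}.

Record BaseCategory := {
  base :> Category;
  fin : base;
  to_fin : forall X : base, Hom X fin;
  to_fin_unique : forall (X : base) (f : Hom X fin), f = to_fin X;
  base_products : forall X Y : base,
    exists (P : base) (p : Hom P X) (q : Hom P Y), is_product p q;
  smooth : forall X Y : base, Hom X Y -> Prop;
  closed : forall X Y : base, Hom X Y -> Prop;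
  (* identities are covered by [smooth_iso] and [closed_iso] *)
  smooth_iso : forall (X Y : base) (f : Hom X Y), is_iso f -> smooth f;
  smooth_comp : forall (X Y Z : base) (f : Hom X Y) (g : Hom Y Z),
    smooth f -> smooth g -> smooth (f >> g);
  closed_iso : forall (X Y : base) (f : Hom X Y), is_iso f -> closed f;
  closed_comp : forall (X Y Z : base) (f : Hom X Y) (g : Hom Y Z),
    closed f -> closed g -> closed (f >> g);
  smooth_pullback : forall (P S T : base) (p : Hom P S) (f : Hom T S),
    smooth p ->
    exists (Q : base) (f' : Hom Q P) (p' : Hom Q T),
      is_pullback f' p' p f /\ smooth p';
  closed_pullback : forall (P S Z Q : base) (p : Hom P S) (z : Hom Z S)
    (z' : Hom Q P) (p' : Hom Q Z),
    smooth p -> closed z -> is_pullback z' p' p z -> closed z';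
  closed_cancel : forall (Z S V : base) (z : Hom Z S) (g : Hom S V),
    closed (z >> g) -> closed z;
  factorization : forall (T S : base) (f : Hom T S),
    exists (P : base) (t : Hom T P) (p : Hom P S),
      closed t /\ smooth p /\ f = t >> p;
  ini : base;
  from_ini : forall X : base, Hom ini X;
  from_ini_unique : forall (X : base) (f : Hom ini X), f = from_ini X;
  (* [compl_mono] and [compl_image]: [compl cz] represents the morphisms
     to [S] whose square with [z] over the initial object is Cartesian *)
  compl : forall (Z S : base) (z : Hom Z S), closed z -> base;
  compl_imm : forall (Z S : base) (z : Hom Z S) (cz : closed z),
    Hom (compl cz) S;
  compl_smooth : forall (Z S : base) (z : Hom Z S) (cz : closed z),
    smooth (compl_imm cz);
  compl_mono : forall (Z S : base) (z : Hom Z S) (cz : closed z)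
    (T : base) (g g' : Hom T (compl cz)),
    g >> compl_imm cz = g' >> compl_imm cz -> g = g';
  compl_image : forall (Z S : base) (z : Hom Z S) (cz : closed z)
    (T : base) (f : Hom T S),
    (exists g : Hom T (compl cz), g >> compl_imm cz = f) <->
    is_pullback (from_ini T) (from_ini Z) f z;
  (* indices are shifted: [Z r] is Z_{r-1}; entries of [Z] beyond
     [n + 1] are irrelevant padding *)
  stratification : forall S : base,
    exists (n : nat) (Z : nat -> base)
           (z : forall r : nat, Hom (Z r) (Z (Datatypes.S r))),
      Z 0 = ini /\ Z (Datatypes.S n) = S /\
      forall r : nat, r <= n ->
        exists cz : closed (z r), smooth (to_fin (compl cz))
}.

Definition in_U (B : BaseCategory) (Y : B) : Prop := smooth (to_fin Y).

Definition U_cat (B : BaseCategory) : Category := full_subcat (@in_U B).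

Definition U_smooth (B : BaseCategory) (X Y : U_cat B) (f : Hom X Y) : Prop :=
  @smooth B (proj1_sig X) (proj1_sig Y) f.

Record FibCat (C : Category) := {
  fib :> C -> Category;
  pull : forall T S : C, Hom T S -> Functor (fib S) (fib T);
  conn : forall (T S V : C) (f : Hom T S) (g : Hom S V) (A : fib V),
    Hom (pull (f >> g) A) (pull f (pull g A));
  conn_inv : forall (T S V : C) (f : Hom T S) (g : Hom S V) (A : fib V),
    Hom (pull f (pull g A)) (pull (f >> g) A);
  conn_invl : forall (T S V : C) (f : Hom T S) (g : Hom S V) (A : fib V),
    conn_inv f g A >> conn f g A = idm (pull f (pull g A));
  conn_invr : forall (T S V : C) (f : Hom T S) (g : Hom S V) (A : fib V),
    conn f g A >> conn_inv f g A = idm (pull (f >> g) A);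
  conn_nat : forall (T S V : C) (f : Hom T S) (g : Hom S V)
    (A B : fib V) (phi : Hom A B),
    fmor (pull (f >> g)) phi >> conn f g B
    = conn f g A >> fmor (pull f) (fmor (pull g) phi);
  pull_id : forall S : C, pull (idm S) = id_functor (fib S);
  conn_cocycle : forall (T S V W : C)
    (f : Hom T S) (g : Hom S V) (h : Hom V W) (A : fib W),
    conn f (g >> h) A >> fmor (pull f) (conn g h A)
    = transport (@pull T W) (comp_assoc f g h) A
      >> conn (f >> g) h A >> conn f g (pull h A)
}.
Arguments pull {C} f0 {T S} _ : rename.
Arguments conn {C f0 T S V} _ _ _ : rename.
Arguments conn_inv {C f0 T S V} _ _ _ : rename.

Notation "f ^* A" := (fob (pull _ f) A)
  (at level 30, right associativity) : cat_scope.
Notation "f ^→ phi" := (fmor (pull _ f) phi)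
  (at level 30, right associativity) : cat_scope.

Definition restrict_fib (C : Category) (P : C -> Prop) (H : FibCat C)
  : FibCat (full_subcat P) :=
  @Build_FibCat (full_subcat P)
    (fun S => H (proj1_sig S))
    (fun T S f => @pull C H _ _ f)
    (fun T S V f g A => @conn C H _ _ _ f g A)
    (fun T S V f g A => @conn_inv C H _ _ _ f g A)
    (fun T S V f g A => @conn_invl C H _ _ _ f g A)
    (fun T S V f g A => @conn_invr C H _ _ _ f g A)
    (fun T S V f g A B phi => @conn_nat C H _ _ _ f g A B phi)
    (fun S => pull_id H (proj1_sig S))
    (fun T S V W f g h A => @conn_cocycle C H _ _ _ _ f g h A).

(** The isomorphism [f'^* p^* A -> p'^* f^* A] of a commutative square. *)
Definition exchange (C : Category) (H : FibCat C) (Q P T S : C)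
  (f' : Hom Q P) (p' : Hom Q T) (p : Hom P S) (f : Hom T S)
  (e : f' >> p = p' >> f) (A : H S) : Hom (f' ^* p ^* A) (p' ^* f ^* A) :=
  conn_inv f' p A >> transport (@pull C H Q S) e A >> conn p' f A.

Record TriFibStructure (C : Category) (H : FibCat C) := {
  tri : forall S : C, TriangulatedStructure (H S);
  tri_pull : forall (T S : C) (f : Hom T S),
    TriFunctorStructure (tri S) (tri T) (pull H f);
  tri_conn : forall (T S V : C) (f : Hom T S) (g : Hom S V) (A : H V),
    fshift (tri_pull (f >> g)) A >> fmor (shift (tri T)) (conn f g A)
    = conn f g (shift (tri V) A)
      >> f ^→ fshift (tri_pull g) A >> fshift (tri_pull f) (g ^* A)
}.

Definition restrict_tri (C : Category) (P : C -> Prop) (H : FibCat C)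
  (tH : TriFibStructure H) : TriFibStructure (restrict_fib P H) :=
  @Build_TriFibStructure (full_subcat P) (restrict_fib P H)
    (fun S => tri tH (proj1_sig S))
    (fun T S f => tri_pull tH f)
    (fun T S V f g A => tri_conn tH f g A).

(** A choice of left adjoints [p_#] to [p^*] for the morphisms [p] in [sm]. *)
Record LeftAdjoints (C : Category) (H : FibCat C)
  (sm : forall X Y : C, Hom X Y -> Prop) := {
  sharp : forall (P S : C) (p : Hom P S), sm P S p -> Functor (H P) (H S);
  sharp_adj : forall (P S : C) (p : Hom P S) (sp : sm P S p),
    Adjunction (sharp sp) (pull H p)
}.

Definition restrict_sharp (B : BaseCategory) (H : FibCat B)
  (L : LeftAdjoints H (@smooth B))
  : LeftAdjoints (restrict_fib (@in_U B) H) (@U_smooth B) :=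
  @Build_LeftAdjoints (U_cat B) (restrict_fib (@in_U B) H) (@U_smooth B)
    (fun P S p sp => sharp L sp)
    (fun P S p sp => sharp_adj L sp).

(** The adjoints are chosen; none of the conditions depends on the choice. *)
Record LocalicStructure (B : BaseCategory) (H : FibCat B) := {
  loc_empty : forall A : H (ini B), is_zero_object A;
  loc_sharp :> LeftAdjoints H (@smooth B);
  loc_base_change : forall (P S T Q : B) (p : Hom P S) (f : Hom T S)
    (f' : Hom Q P) (p' : Hom Q T)
    (sp : smooth p) (sp' : smooth p') (sq : is_pullback f' p' p f) (A : H P),
    is_iso
      (fmor (sharp loc_sharp sp') (f' ^→ adj_unit (sharp_adj loc_sharp sp) A)
       >> fmor (sharp loc_sharp sp')
               (exchange (proj1 sq) (sharp loc_sharp sp A))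
       >> adj_counit (sharp_adj loc_sharp sp') (f ^* sharp loc_sharp sp A));
  lower : forall (Z S : B) (z : Hom Z S), closed z -> Functor (H Z) (H S);
  lower_adj : forall (Z S : B) (z : Hom Z S) (cz : closed z),
    Adjunction (pull H z) (lower cz);
  lower_ff : forall (Z S : B) (z : Hom Z S) (cz : closed z),
    fully_faithful (lower cz);
  loc_conservative : forall (Z S : B) (z : Hom Z S) (cz : closed z)
    (A A' : H S) (phi : Hom A A'),
    is_iso (z ^→ phi) -> is_iso (compl_imm cz ^→ phi) -> is_iso phi
}.

Record InternalTensor (C : Category) (H : FibCat C) := {
  tens : forall S : C, Functor (prod_cat (H S) (H S)) (H S);
  tm : forall (T S : C) (f : Hom T S) (A B : H S),
    Hom (bob (tens T) (f ^* A) (f ^* B)) (f ^* bob (tens S) A B);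
  tm_iso : forall (T S : C) (f : Hom T S) (A B : H S), is_iso (tm f A B);
  tm_nat : forall (T S : C) (f : Hom T S) (A A' B B' : H S)
    (phi : Hom A A') (psi : Hom B B'),
    bmor (tens T) (f ^→ phi) (f ^→ psi) >> tm f A' B'
    = tm f A B >> f ^→ bmor (tens S) phi psi;
  tm_comp : forall (T S V : C) (f : Hom T S) (g : Hom S V) (A B : H V),
    tm (f >> g) A B >> conn f g (bob (tens V) A B)
    = bmor (tens T) (conn f g A) (conn f g B)
      >> tm f (g ^* A) (g ^* B) >> f ^→ tm g A B
}.
Arguments tens {C H} _ _.
Arguments tm {C H} _ {T S} _ _ _.

Notation "A ⊗[ T ] B" := (bob (tens T _) A B)
  (at level 40, left associativity, format "A  ⊗[ T ]  B") : cat_scope.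
Notation "phi ⊠[ T ] psi" := (bmor (tens T _) phi psi)
  (at level 40, left associativity, format "phi  ⊠[ T ]  psi") : cat_scope.

Definition restrict_tensor (C : Category) (P : C -> Prop) (H : FibCat C)
  (T : InternalTensor H) : InternalTensor (restrict_fib P H) :=
  @Build_InternalTensor (full_subcat P) (restrict_fib P H)
    (fun S => tens T (proj1_sig S))
    (fun X S f A B => tm T f A B)
    (fun X S f A B => tm_iso T f A B)
    (fun X S f A A' B B' phi psi => tm_nat T f phi psi)
    (fun X S V f g A B => tm_comp T f g A B).

(** The [tm] are isomorphisms of bi-triangulated functors between
    [f^* A ⊗ f^* B] and [f^* (A ⊗ B)]. *)
Record TriTensorStructure (C : Category) (H : FibCat C)
  (tH : TriFibStructure H) (T : InternalTensor H) := {
  tri_tens : forall S : C,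
    BiTriFunctorStructure (tri tH S) (tri tH S) (tri tH S) (tens T S);
  tri_tm_l : forall (X S : C) (f : Hom X S) (A B : H S),
    tm T f (shift (tri tH S) A) B >> f ^→ shiftl (tri_tens S) A B
      >> fshift (tri_pull tH f) (A ⊗[T] B)
    = fshift (tri_pull tH f) A ⊠[T] idm (f ^* B)
      >> shiftl (tri_tens X) (f ^* A) (f ^* B)
      >> fmor (shift (tri tH X)) (tm T f A B);
  tri_tm_r : forall (X S : C) (f : Hom X S) (A B : H S),
    tm T f A (shift (tri tH S) B) >> f ^→ shiftr (tri_tens S) A B
      >> fshift (tri_pull tH f) (A ⊗[T] B)
    = idm (f ^* A) ⊠[T] fshift (tri_pull tH f) B
      >> shiftr (tri_tens X) (f ^* A) (f ^* B)
      >> fmor (shift (tri tH X)) (tm T f A B)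
}.

Definition localic_tensor (C : Category) (H : FibCat C)
  (sm : forall X Y : C, Hom X Y -> Prop) (L : LeftAdjoints H sm)
  (T : InternalTensor H) : Prop :=
  (forall (P S : C) (p : Hom P S) (sp : sm P S p) (A : H P) (B : H S),
    is_iso
      (fmor (sharp L sp) (adj_unit (sharp_adj L sp) A ⊠[T] idm (p ^* B))
       >> fmor (sharp L sp) (tm T p (sharp L sp A) B)
       >> adj_counit (sharp_adj L sp) (sharp L sp A ⊗[T] B)))
  /\
  (forall (P S : C) (p : Hom P S) (sp : sm P S p) (A : H S) (B : H P),
    is_iso
      (fmor (sharp L sp) (idm (p ^* A) ⊠[T] adj_unit (sharp_adj L sp) B)
       >> fmor (sharp L sp) (tm T p A (sharp L sp B))
       >> adj_counit (sharp_adj L sp) (A ⊗[T] sharp L sp B))).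

Record AssocConstraint (C : Category) (H : FibCat C) (T : InternalTensor H)
  := {
  ac : forall (S : C) (A B D : H S),
    Hom (A ⊗[T] B ⊗[T] D) (A ⊗[T] (B ⊗[T] D));
  ac_iso : forall (S : C) (A B D : H S), is_iso (ac A B D);
  ac_nat : forall (S : C) (A A' B B' D D' : H S)
    (f : Hom A A') (g : Hom B B') (h : Hom D D'),
    f ⊠[T] g ⊠[T] h >> ac A' B' D' = ac A B D >> f ⊠[T] (g ⊠[T] h);
  ac_pentagon : forall (S : C) (A B D E : H S),
    ac A B D ⊠[T] idm E >> ac A (B ⊗[T] D) E >> idm A ⊠[T] ac B D E
    = ac (A ⊗[T] B) D E >> ac A B (D ⊗[T] E);
  ac_pull : forall (X S : C) (f : Hom X S) (A B D : H S),
    tm T f A B ⊠[T] idm (f ^* D) >> tm T f (A ⊗[T] B) D >> f ^→ ac A B D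
    = ac (f ^* A) (f ^* B) (f ^* D)
      >> idm (f ^* A) ⊠[T] tm T f B D >> tm T f A (B ⊗[T] D)
}.

Record CommConstraint (C : Category) (H : FibCat C) (T : InternalTensor H)
  := {
  cc : forall (S : C) (A B : H S), Hom (A ⊗[T] B) (B ⊗[T] A);
  cc_nat : forall (S : C) (A A' B B' : H S) (f : Hom A A') (g : Hom B B'),
    f ⊠[T] g >> cc A' B' = cc A B >> g ⊠[T] f;
  cc_invol : forall (S : C) (A B : H S), cc A B >> cc B A = idm (A ⊗[T] B);
  cc_pull : forall (X S : C) (f : Hom X S) (A B : H S),
    cc (f ^* A) (f ^* B) >> tm T f B A = tm T f A B >> f ^→ cc A B
}.

Record FibSection (C : Category) (H : FibCat C) := {
  sec : forall S : C, H S;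
  sec_pull : forall (T S : C) (f : Hom T S), Hom (f ^* sec S) (sec T);
  sec_iso : forall (T S : C) (f : Hom T S), is_iso (sec_pull f);
  sec_comp : forall (V T S : C) (f : Hom V T) (g : Hom T S),
    sec_pull (f >> g)
    = conn f g (sec S) >> f ^→ sec_pull g >> sec_pull f
}.

Record UnitConstraint (C : Category) (H : FibCat C) (T : InternalTensor H)
  := {
  one : FibSection H;
  ur : forall (S : C) (A : H S), Hom (A ⊗[T] sec one S) A;
  ul : forall (S : C) (B : H S), Hom (sec one S ⊗[T] B) B;
  ur_iso : forall (S : C) (A : H S), is_iso (ur A);
  ul_iso : forall (S : C) (B : H S), is_iso (ul B);
  ur_nat : forall (S : C) (A A' : H S) (f : Hom A A'),
    f ⊠[T] idm (sec one S) >> ur A' = ur A >> f;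
  ul_nat : forall (S : C) (B B' : H S) (g : Hom B B'),
    idm (sec one S) ⊠[T] g >> ul B' = ul B >> g;
  ur_ul : forall S : C, ur (sec one S) = ul (sec one S);
  ur_pull : forall (X S : C) (f : Hom X S) (A : H S),
    idm (f ^* A) ⊠[T] sec_pull one f >> ur (f ^* A)
    = tm T f A (sec one S) >> f ^→ ur A;
  ul_pull : forall (X S : C) (f : Hom X S) (B : H S),
    sec_pull one f ⊠[T] idm (f ^* B) >> ul (f ^* B)
    = tm T f (sec one S) B >> f ^→ ul B
}.
Arguments ac {C H T} _ {S} _ _ _.
Arguments cc {C H T} _ {S} _ _.
Arguments ur {C H T} _ {S} _.
Arguments ul {C H T} _ {S} _.

Definition restrict_assoc (C : Category) (P : C -> Prop) (H : FibCat C)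
  (T : InternalTensor H) (a : AssocConstraint T)
  : AssocConstraint (restrict_tensor P T) :=
  @Build_AssocConstraint (full_subcat P) (restrict_fib P H)
    (restrict_tensor P T)
    (fun S A B D => ac a A B D)
    (fun S A B D => ac_iso a A B D)
    (fun S A A' B B' D D' f g h => ac_nat a f g h)
    (fun S A B D E => ac_pentagon a A B D E)
    (fun X S f A B D => ac_pull a f A B D).

Definition restrict_comm (C : Category) (P : C -> Prop) (H : FibCat C)
  (T : InternalTensor H) (c : CommConstraint T)
  : CommConstraint (restrict_tensor P T) :=
  @Build_CommConstraint (full_subcat P) (restrict_fib P H)
    (restrict_tensor P T)
    (fun S A B => cc c A B)
    (fun S A A' B B' f g => cc_nat c f g)
    (fun S A B => cc_invol c A B)
    (fun X S f A B => cc_pull c f A B).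

Definition restrict_section (C : Category) (P : C -> Prop) (H : FibCat C)
  (A : FibSection H) : FibSection (restrict_fib P H) :=
  @Build_FibSection (full_subcat P) (restrict_fib P H)
    (fun S => sec A (proj1_sig S))
    (fun T S f => sec_pull A f)
    (fun T S f => sec_iso A f)
    (fun V T S f g => sec_comp A f g).

Definition restrict_unit (C : Category) (P : C -> Prop) (H : FibCat C)
  (T : InternalTensor H) (u : UnitConstraint T)
  : UnitConstraint (restrict_tensor P T) :=
  @Build_UnitConstraint (full_subcat P) (restrict_fib P H)
    (restrict_tensor P T)
    (restrict_section P (one u))
    (fun S A => ur u A)
    (fun S B => ul u B)
    (fun S A => ur_iso u A)
    (fun S B => ul_iso u B)
    (fun S A A' f => ur_nat u f)
    (fun S B B' g => ul_nat u g)
    (fun S => ur_ul u (proj1_sig S))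
    (fun X S f A => ur_pull u f A)
    (fun X S f B => ul_pull u f B).

(** [extends_* e x' x]: the constraint [x'] on [T'] restricts to [x] on [T],
    where [e] identifies the restriction of [T'] with [T]. *)
Definition extends_assoc (C : Category) (P : C -> Prop) (H : FibCat C)
  (T' : InternalTensor H) (T : InternalTensor (restrict_fib P H))
  (e : restrict_tensor P T' = T)
  (a' : AssocConstraint T') (a : AssocConstraint T) : Prop :=
  eq_rect _ (fun X => AssocConstraint X) (restrict_assoc P a') _ e = a.

Definition extends_comm (C : Category) (P : C -> Prop) (H : FibCat C)
  (T' : InternalTensor H) (T : InternalTensor (restrict_fib P H))
  (e : restrict_tensor P T' = T)
  (c' : CommConstraint T') (c : CommConstraint T) : Prop :=
  eq_rect _ (fun X => CommConstraint X) (restrict_comm P c') _ e = c.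

Definition extends_unit (C : Category) (P : C -> Prop) (H : FibCat C)
  (T' : InternalTensor H) (T : InternalTensor (restrict_fib P H))
  (e : restrict_tensor P T' = T)
  (u' : UnitConstraint T') (u : UnitConstraint T) : Prop :=
  eq_rect _ (fun X => UnitConstraint X) (restrict_unit P u') _ e = u.

Definition compatible_ac (C : Category) (H : FibCat C) (T : InternalTensor H)
  (a : AssocConstraint T) (c : CommConstraint T) : Prop :=
  forall (S : C) (A B D : H S),
    cc c A B ⊠[T] idm D >> ac a B A D >> idm B ⊠[T] cc c A D
    = ac a A B D >> cc c A (B ⊗[T] D) >> ac a B D A.

Definition compatible_au (C : Category) (H : FibCat C) (T : InternalTensor H)
  (a : AssocConstraint T) (u : UnitConstraint T) : Prop :=
  forall S : C,
    (forall B D : H S,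
      ac a (sec (one u) S) B D >> ul u (B ⊗[T] D) = ul u B ⊠[T] idm D) /\
    (forall A D : H S,
      ac a A (sec (one u) S) D >> idm A ⊠[T] ul u D = ur u A ⊠[T] idm D) /\
    (forall A B : H S,
      ac a A B (sec (one u) S) >> idm A ⊠[T] ur u B = ur u (A ⊗[T] B)).

Definition compatible_cu (C : Category) (H : FibCat C) (T : InternalTensor H)
  (c : CommConstraint T) (u : UnitConstraint T) : Prop :=
  forall (S : C) (B : H S), cc c (sec (one u) S) B >> ur u B = ul u B.

(* Main.v *)
Require Import Defs.
From Corelib Require Import ssreflect.
Set Implicit Arguments.
Unset Strict Implicit.
Unset Printing Implicit Defensive.

(** Factor [S -> *] as a closed immersion [t : S -> P] followed by a smooth
    morphism, so that [P] lies in [U].  Since [t_*] is fully faithful, every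
    object over [S] is isomorphic to [t^*] of an object over [P].  The
    constraints are natural and commute with [t^*], so the coherence identities
    over [P] imply those over [S]. *)

(** * Composition and isomorphisms *)

Lemma comp_eq_assoc (C : Category) (X Y Z W : C) (f : Hom X Y) (g : Hom Y Z)
  (h : Hom X Z) : f >> g = h -> forall k : Hom Z W, f >> (g >> k) = h >> k.
Proof. by move=> <- k; rewrite comp_assoc. Qed.

Lemma comp_eq_assoc3 (C : Category) (X Y Z V W : C) (f : Hom X Y)
  (g : Hom Y Z) (g' : Hom Z V) (h : Hom X V) :
  f >> (g >> g') = h -> forall k : Hom V W, f >> (g >> (g' >> k)) = h >> k.
Proof. by move=> <- k; rewrite !comp_assoc. Qed.

(* Rewrites with an equation whose left-hand side is a right-associated
   composite, anywhere inside a right-associated composite. *)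
Ltac crw E :=
  first [ rewrite (comp_eq_assoc3 E)
        | rewrite (comp_eq_assoc E) | rewrite E ];
  rewrite -?comp_assoc.

Lemma is_iso_idm (C : Category) (A : C) : is_iso (idm A).
Proof. by exists (idm A); rewrite comp_idl. Qed.

Lemma is_iso_comp (C : Category) (A B D : C) (f : Hom A B) (g : Hom B D) :
  is_iso f -> is_iso g -> is_iso (f >> g).
Proof.
move=> [f' [ff' f'f]] [g' [gg' g'g]]; exists (g' >> f'); split.
- by rewrite -comp_assoc (comp_assoc g) gg' comp_idl.
- by rewrite -comp_assoc (comp_assoc f') f'f comp_idl.
Qed.

Lemma is_iso_epi (C : Category) (A B D : C) (f : Hom A B) (g h : Hom B D) :
  is_iso f -> f >> g = f >> h -> g = h.
Proof.
move=> [f' [_ f'f]] e.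
by rewrite -(comp_idl g) -(comp_idl h) -f'f -!comp_assoc e.
Qed.

Lemma is_iso_mono (C : Category) (A B D : C) (f g : Hom A B) (h : Hom B D) :
  is_iso h -> f >> h = g >> h -> f = g.
Proof.
move=> [h' [hh' _]] e.
by rewrite -(comp_idr f) -(comp_idr g) -hh' !comp_assoc e.
Qed.

(** * Bifunctors *)

Section Bifunctors.
Variables (C D E : Category) (F : Functor (prod_cat C D) E).

Lemma bmor_id (A : C) (B : D) : bmor F (idm A) (idm B) = idm (bob F A B).
Proof. exact: (fmor_id F (A, B)). Qed.

Lemma bmor_comp (A A' A'' : C) (B B' B'' : D) (f : Hom A A') (f' : Hom A' A'')
  (g : Hom B B') (g' : Hom B' B'') :
  bmor F f g >> bmor F f' g' = bmor F (f >> f') (g >> g').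
Proof.
by rewrite -(@fmor_comp _ _ F (A, B) (A', B') (A'', B'') (f, g) (f', g')).
Qed.

Lemma bmor_comp_l (A A' A'' : C) (B : D) (f : Hom A A') (f' : Hom A' A'') :
  bmor F (f >> f') (idm B) = bmor F f (idm B) >> bmor F f' (idm B).
Proof. by rewrite bmor_comp comp_idl. Qed.

Lemma bmor_comp_r (A : C) (B B' B'' : D) (g : Hom B B') (g' : Hom B' B'') :
  bmor F (idm A) (g >> g') = bmor F (idm A) g >> bmor F (idm A) g'.
Proof. by rewrite bmor_comp comp_idl. Qed.

(** Together with [bmor_split_r] this gives the interchange law: maps acting on different variables
    slide past each other. *)
Lemma bmor_split_l (A A' : C) (B B' : D) (f : Hom A A') (g : Hom B B') :
  bmor F f g = bmor F f (idm B) >> bmor F (idm A') g.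
Proof. by rewrite bmor_comp comp_idl comp_idr. Qed.

Lemma bmor_split_r (A A' : C) (B B' : D) (f : Hom A A') (g : Hom B B') :
  bmor F f g = bmor F (idm A) g >> bmor F f (idm B').
Proof. by rewrite bmor_comp comp_idl comp_idr. Qed.

Lemma is_iso_bmor (A A' : C) (B B' : D) (f : Hom A A') (g : Hom B B') :
  is_iso f -> is_iso g -> is_iso (bmor F f g).
Proof.
move=> [f' [ff' f'f]] [g' [gg' g'g]]; exists (bmor F f' g').
by rewrite !bmor_comp ff' f'f gg' g'g !bmor_id.
Qed.

End Bifunctors.

(** * Essential surjectivity of pullback along closed immersions *)

Lemma counit_iso (C D : Category) (L : Functor C D) (R : Functor D C)
  (adj : Adjunction L R) (Y : D) :
  fully_faithful R -> is_iso (adj_counit adj Y).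
Proof.
(* The inverse [s] of the counit is the preimage under [R] of the unit at [R Y]. One composite is
   the identity after applying [R], hence by faithfulness; the other follows from naturality of the
   counit. *)
move=> ff; have [s [Rs _]] := ff _ _ (adj_unit adj (R Y)).
exists s; split; last first.
- have [i [_ iuniq]] := ff _ _ (idm (R Y)).
  rewrite -(iuniq (s >> adj_counit adj Y)) ?(iuniq (idm Y)) ?fmor_id //.
  by rewrite fmor_comp Rs triangle_r.
- by rewrite -counit_nat Rs triangle_l.
Qed.

Lemma closed_into_U (B : BaseCategory) (S : B) :
  exists (P : B) (t : Hom S P), in_U P /\ closed t.
Proof.
have [P [t [p [ct [sp _]]]]] := factorization (to_fin S).
by exists P, t; split=> //; rewrite /in_U -(to_fin_unique p).
Qed.

Lemma pull_closed_es (B : BaseCategory) (H : FibCat B) (lH : LocalicStructure H)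
  (S P : B) (t : Hom S P) : closed t -> essentially_surjective (pull H t).
Proof.
move=> ct A; exists (lower lH ct A), (adj_counit (lower_adj lH ct) A).
apply: counit_iso; exact: lower_ff.
Qed.

(** * Naturality of [tm] and the pullback axioms of the constraints *)

Section Pullback.
Variables (C : Category) (H : FibCat C) (T : InternalTensor H).
Variables (X S : C) (f : Hom X S).

Lemma tm_nat_l (A A' D : H S) (phi : Hom A A') :
  (f^→ phi) ⊠[T] idm (f^*D) >> tm T f A' D
  = tm T f A D >> f^→ (phi ⊠[T] idm D).
Proof. by rewrite -tm_nat fmor_id. Qed.

Lemma tm_nat_r (A D D' : H S) (phi : Hom D D') :
  idm (f^*A) ⊠[T] (f^→ phi) >> tm T f A D'
  = tm T f A D >> f^→ (idm A ⊠[T] phi).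
Proof. by rewrite -tm_nat fmor_id. Qed.

(** Right-nested form of [ac_pull] for [crw]: it trades [ac] over [X] for the pullback of [ac] over
    [S] while moving the [tm] to the front. *)
Lemma ac_pull_assoc (a : AssocConstraint T) (A B D : H S) :
  ac a (f^*A) (f^*B) (f^*D)
  >> (idm (f^*A) ⊠[T] tm T f B D >> tm T f A (B ⊗[T] D))
  = tm T f A B ⊠[T] idm (f^*D)
    >> (tm T f (A ⊗[T] B) D >> f^→ ac a A B D).
Proof. by rewrite !comp_assoc ac_pull. Qed.

Lemma cc_pull_l (c : CommConstraint T) (A B : H S) (D : H X) :
  cc c (f^*A) (f^*B) ⊠[T] idm D >> tm T f B A ⊠[T] idm D
  = tm T f A B ⊠[T] idm D >> (f^→ cc c A B) ⊠[T] idm D.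
Proof. by rewrite !bmor_comp cc_pull. Qed.

Lemma cc_pull_r (c : CommConstraint T) (A B : H S) (D : H X) :
  idm D ⊠[T] cc c (f^*A) (f^*B) >> idm D ⊠[T] tm T f B A
  = idm D ⊠[T] tm T f A B >> idm D ⊠[T] (f^→ cc c A B).
Proof. by rewrite !bmor_comp cc_pull. Qed.

Lemma tm_r_iso (A B : H S) (D : H X) : is_iso (idm D ⊠[T] tm T f A B).
Proof. apply: is_iso_bmor; [exact: is_iso_idm|exact: tm_iso]. Qed.

End Pullback.

(** * Transfer of the coherence identities along an essentially surjective pullback *)

Section Transfer.
Variables (C : Category) (H : FibCat C) (T : InternalTensor H).
Variables (X S : C) (f : Hom X S).
Hypothesis f_es : essentially_surjective (pull H f).

(** Naturality reduces the claim to objects of the form [f^*A], [f^*B], [f^*D]. There, followed by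
    [tm] at the target, each path becomes [tm] at the source followed by the pullback of the
    corresponding path over [S]. *)
Lemma hexagon_pull (a : AssocConstraint T) (c : CommConstraint T) :
  (forall A B D : H S,
    cc c A B ⊠[T] idm D >> ac a B A D >> idm B ⊠[T] cc c A D
    = ac a A B D >> cc c A (B ⊗[T] D) >> ac a B D A) ->
  forall A B D : H X,
    cc c A B ⊠[T] idm D >> ac a B A D >> idm B ⊠[T] cc c A D
    = ac a A B D >> cc c A (B ⊗[T] D) >> ac a B D A.
Proof.
move=> hS A' B' D'.
have [A [i ii]] := f_es A'; have [B [j ij]] := f_es B'.
have [D [k ik]] := f_es D'.
apply: (@is_iso_epi _ _ _ _ (i ⊠[T] j ⊠[T] k)).
  by do !apply: is_iso_bmor.
(* The maps [i], [j], [k] are pushed through to the target, where they appear in the order [j], [k],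
   [i] on both paths and cancel. *)
transitivity (cc c (f^*A) (f^*B) ⊠[T] idm (f^*D) >> ac a (f^*B) (f^*A) (f^*D)
  >> idm (f^*B) ⊠[T] cc c (f^*A) (f^*D) >> j ⊠[T] (k ⊠[T] i)).
  have e1 : i ⊠[T] j ⊠[T] k >> cc c A' B' ⊠[T] idm D'
    = cc c (f^*A) (f^*B) ⊠[T] idm (f^*D) >> j ⊠[T] i ⊠[T] k.
    by rewrite !bmor_comp cc_nat comp_idl comp_idr.
  rewrite -!comp_assoc; crw e1; crw (ac_nat a j i k).
  by rewrite !bmor_comp cc_nat comp_idl comp_idr.
transitivity (ac a (f^*A) (f^*B) (f^*D) >> cc c (f^*A) (f^*B ⊗[T] f^*D)
  >> ac a (f^*B) (f^*D) (f^*A) >> j ⊠[T] (k ⊠[T] i)); last first.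
  rewrite -!comp_assoc; crw (ac_nat a i j k).
  crw (cc_nat c i (j ⊠[T] k)).
  by crw (ac_nat a j k i).
congr (_ >> _).
(* The appended isomorphism identifies the common target with [f^*] of [B ⊗ (D ⊗ A)]. *)
apply: (@is_iso_mono _ _ _ _ _ _
  (idm (f^*B) ⊠[T] tm T f D A >> tm T f B (D ⊗[T] A))).
  by apply: is_iso_comp; [exact: tm_r_iso|exact: tm_iso].
transitivity (tm T f A B ⊠[T] idm (f^*D) >> tm T f (A ⊗[T] B) D
  >> f^→ (cc c A B ⊠[T] idm D >> ac a B A D >> idm B ⊠[T] cc c A D)).
  rewrite !fmor_comp -!comp_assoc.
  crw (cc_pull_r f c A D (f^*B)).
  crw (tm_nat_r T f B (cc c A D)).
  crw (ac_pull_assoc f a B A D).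
  crw (cc_pull_l f c A B (f^*D)).
  by crw (tm_nat_l T f D (cc c A B)).
rewrite hS !fmor_comp -!comp_assoc.
crw (ac_pull_assoc f a B D A).
(* Naturality of [cc] is read backwards to carry [tm f B D] from the second factor to the first. *)
crw (eq_sym (cc_nat c (idm (f^*A)) (tm T f B D))).
crw (cc_pull c f A (B ⊗[T] D)).
by crw (ac_pull_assoc f a A B D).
Qed.

Variable u : UnitConstraint T.

(** Only [B'] and [D'] are replaced by pullbacks up to a chosen isomorphism; for the unit, the
    section itself supplies [s] from the pullback of the unit over [S]. *)
Lemma unit_l_pull (a : AssocConstraint T) :
  (forall B D : H S,
    ac a (sec (one u) S) B D >> ul u (B ⊗[T] D) = ul u B ⊠[T] idm D) ->
  forall B D : H X,
    ac a (sec (one u) X) B D >> ul u (B ⊗[T] D) = ul u B ⊠[T] idm D.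
Proof.
move=> hS B' D'.
have [B [j ij]] := f_es B'; have [D [k ik]] := f_es D'.
set s := sec_pull (one u) f.
apply: (@is_iso_epi _ _ _ _ (s ⊠[T] j ⊠[T] k)).
  by do !apply: is_iso_bmor => //; exact: sec_iso.
(* This isolates [s] next to [ul] at the pulled-back object, the shape required by [ul_pull]. *)
have e1 (E E' : H X) (h : Hom E E') :
    s ⊠[T] h >> ul u E' = s ⊠[T] idm E >> (ul u E >> h).
  by rewrite -ul_nat comp_assoc -bmor_split_l.
rewrite comp_assoc ac_nat -comp_assoc bmor_comp !e1 comp_idr.
transitivity (s ⊠[T] idm (f^*B) ⊠[T] idm (f^*D)
   >> ul u (f^*B) ⊠[T] idm (f^*D) >> j ⊠[T] k); last first.
  by rewrite !bmor_comp !comp_idl -comp_assoc.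
rewrite !comp_assoc; congr (_ >> _).
apply: (@is_iso_mono _ _ _ _ _ _ (tm T f B D)); first exact: tm_iso.
rewrite -!comp_assoc -ul_nat.
(* Interchange puts [tm f B D] before [s], so that [ul_pull] applies at [B ⊗ D]. *)
rewrite (comp_assoc (s ⊠[T] _)) -bmor_split_l (bmor_split_r _ s (tm T f B D)).
rewrite -comp_assoc ul_pull.
crw (ac_pull_assoc f a (sec (one u) S) B D).
rewrite -fmor_comp hS -tm_nat_l.
by rewrite !comp_assoc !bmor_comp !comp_idl ul_pull.
Qed.

Lemma unit_m_pull (a : AssocConstraint T) :
  (forall A D : H S,
    ac a A (sec (one u) S) D >> idm A ⊠[T] ul u D = ur u A ⊠[T] idm D) ->
  forall A D : H X,
    ac a A (sec (one u) X) D >> idm A ⊠[T] ul u D = ur u A ⊠[T] idm D.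
Proof.
move=> hS A' D'.
have [A [i ii]] := f_es A'; have [D [k ik]] := f_es D'.
set s := sec_pull (one u) f.
apply: (@is_iso_epi _ _ _ _ (i ⊠[T] s ⊠[T] k)).
  by do !apply: is_iso_bmor => //; exact: sec_iso.
have e1 : s ⊠[T] k >> ul u D' = s ⊠[T] idm (f^*D) >> ul u (f^*D) >> k.
  by rewrite -comp_assoc -ul_nat comp_assoc -bmor_split_l.
have e2 : i ⊠[T] s >> ur u A' = idm (f^*A) ⊠[T] s >> ur u (f^*A) >> i.
  by rewrite -comp_assoc -ur_nat comp_assoc -bmor_split_r.
(* The unit axioms absorb [s] on both sides, through [ul] on the left and [ur] on the right. *)
rewrite comp_assoc ac_nat -comp_assoc !bmor_comp e1 e2 ul_pull ur_pull.
(* The inserted identities allow [i ⊠ k] to be split off at the end of both sides. *)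
rewrite !comp_idr -[i in LHS]comp_idl -[k in RHS]comp_idl -!bmor_comp comp_assoc.
congr (_ >> _).
apply: (@is_iso_mono _ _ _ _ _ _ (tm T f A D)); first exact: tm_iso.
rewrite bmor_comp_l bmor_comp_r -!comp_assoc.
crw (tm_nat_r T f A (ul u D)).
crw (ac_pull_assoc f a A (sec (one u) S) D).
by rewrite -fmor_comp hS -tm_nat_l.
Qed.

(** Mirror image of [unit_l_pull]: [ur_pull] is applied at [B] inside the tensor product and at
    [A ⊗ B] outside. *)
Lemma unit_r_pull (a : AssocConstraint T) :
  (forall A B : H S,
    ac a A B (sec (one u) S) >> idm A ⊠[T] ur u B = ur u (A ⊗[T] B)) ->
  forall A B : H X,
    ac a A B (sec (one u) X) >> idm A ⊠[T] ur u B = ur u (A ⊗[T] B).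
Proof.
move=> hS A' B'.
have [A [i ii]] := f_es A'; have [B [j ij]] := f_es B'.
set s := sec_pull (one u) f.
apply: (@is_iso_epi _ _ _ _ (i ⊠[T] j ⊠[T] s)).
  by do !apply: is_iso_bmor => //; exact: sec_iso.
have e1 (E E' : H X) (h : Hom E E') :
    h ⊠[T] s >> ur u E' = idm E ⊠[T] s >> (ur u E >> h).
  by rewrite -ur_nat comp_assoc -bmor_split_r.
rewrite comp_assoc ac_nat -comp_assoc bmor_comp !e1 comp_idr.
rewrite comp_assoc -{1}[i]comp_idl (comp_assoc (_ ⊠[T] s)) ur_pull -bmor_comp.
rewrite !comp_assoc; congr (_ >> _).
apply: (@is_iso_mono _ _ _ _ _ _ (tm T f A B)); first exact: tm_iso.
rewrite -!comp_assoc -ur_nat.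
rewrite (comp_assoc (_ ⊠[T] s)) -bmor_split_r (bmor_split_l _ (tm T f A B) s).
rewrite -comp_assoc ur_pull bmor_comp_r -!comp_assoc.
crw (tm_nat_r T f A (ur u B)).
crw (ac_pull_assoc f a A B (sec (one u) S)).
by rewrite -fmor_comp hS.
Qed.

(** After [ur_pull], [ul_pull] and [cc_pull], both sides start with the same [tm] and end with [j];
    between them stand the pullbacks of the two sides of [hS]. *)
Lemma comm_unit_pull (c : CommConstraint T) :
  (forall B : H S, cc c (sec (one u) S) B >> ur u B = ul u B) ->
  forall B : H X, cc c (sec (one u) X) B >> ur u B = ul u B.
Proof.
move=> hS B'; have [B [j ij]] := f_es B'.
set s := sec_pull (one u) f.
apply: (@is_iso_epi _ _ _ _ (s ⊠[T] j)).
  by apply: is_iso_bmor => //; exact: sec_iso.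
rewrite comp_assoc cc_nat (bmor_split_r _ j s) (bmor_split_l _ s j) -!comp_assoc.
rewrite ur_nat ul_nat (comp_assoc (_ ⊠[T] s)) (comp_assoc (s ⊠[T] _)).
rewrite ur_pull ul_pull !comp_assoc cc_pull.
by rewrite -(comp_assoc (tm T f _ _) _ (f^→ ur u B)) -fmor_comp hS.
Qed.

End Transfer.

Theorem lemma3p11
  (B : BaseCategory)
  (H : FibCat B) (tH : TriFibStructure H) (lH : LocalicStructure H)
  (T : InternalTensor (restrict_fib (@in_U B) H))
  (tT : TriTensorStructure (restrict_tri (@in_U B) tH) T)
  (lT : localic_tensor (restrict_sharp lH) T)
  (T' : InternalTensor H) (tT' : TriTensorStructure tH T')
  (e : restrict_tensor (@in_U B) T' = T) :
  (forall (a : AssocConstraint T) (c : CommConstraint T)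
          (a' : AssocConstraint T') (c' : CommConstraint T'),
     extends_assoc e a' a -> extends_comm e c' c ->
     compatible_ac a c -> compatible_ac a' c')
  /\
  (forall (a : AssocConstraint T) (u : UnitConstraint T)
          (a' : AssocConstraint T') (u' : UnitConstraint T'),
     extends_assoc e a' a -> extends_unit e u' u ->
     compatible_au a u -> compatible_au a' u')
  /\
  (forall (c : CommConstraint T) (u : UnitConstraint T)
          (c' : CommConstraint T') (u' : UnitConstraint T'),
     extends_comm e c' c -> extends_unit e u' u ->
     compatible_cu c u -> compatible_cu c' u').
Proof.
(* Once [T] is literally the restriction of [T'], the transports in the [extends_*] hypotheses
   compute away, and the given constraints can be replaced by restrictions. *)
destruct e.
split; [|split].
- move=> a c a' c' <- <- /= hU S.
  have [P [t [uP ct]]] := closed_into_U S.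
  apply: (hexagon_pull (pull_closed_es lH ct)).
  (* Over [P] in [U], the restricted fibre is [H P] by definition, so [hU] is the identity required
     there. *)
  exact: (hU (exist _ P uP)).
- move=> a u a' u' <- <- /= hU S.
  have [P [t [uP ct]]] := closed_into_U S.
  have es := pull_closed_es lH ct.
  have [hl [hm hr]] := hU (exist _ P uP).
  split; [|split].
  + exact: (unit_l_pull es hl).
  + exact: (unit_m_pull es hm).
  + exact: (unit_r_pull es hr).
- move=> c u c' u' <- <- /= hU S.
  have [P [t [uP ct]]] := closed_into_U S.
  apply: (comm_unit_pull (pull_closed_es lH ct)).
  exact: (hU (exist _ P uP)).
Qed.
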